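(* Let $0<t<1$, $m\ge1$, and set $q=0$. For all $\vec{\mathsf{x}},\vec{\mathsf{y}}\in\mathbb{W}_m$ with $\mathsf{y}_i-\mathsf{x}_i\in\{-1,0\}$ for all $1\le i\le m$, the quantity $\Upsilon_m(\vec{\mathsf{x}},\vec{\mathsf{y}})$ at $q=0$ is equal to $$t^{-\binom m2}\left(t^{\mathsf{x}_m}\mathbf{1}_{\mathsf{y}_m=\mathsf{x}_m}+(1-t^{\mathsf{x}_m})\mathbf{1}_{\mathsf{y}_m=\mathsf{x}_m-1}\right)\prod_{i=1}^{m-1}\left(t^{\mathsf{x}_i}\mathbf{1}_{\mathsf{y}_i=\mathsf{x}_i}+t^{m-i}\mathbf{1}_{\mathsf{y}_i=\mathsf{x}_i-1}\right)\left(1-t^{\mathsf{x}_i-\mathsf{x}_{i+1}-1}\mathbf{1}_{\mathsf{y}_i=\mathsf{x}_i-1}\mathbf{1}_{\mathsf{y}_{i+1}=\mathsf{x}_{i+1}}\right).$$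
   Context: $\mathbb{W}_m$ is the set of integer vectors $\vec{\mathsf{x}}=(\mathsf{x}_1>\dots>\mathsf{x}_m\ge0)$; $\mathbf{1}_A$ is the indicator of $A$. For $|p|<1$, $(z;p)_\infty=\prod_{i\ge 0}(1-zp^i)$, and $$V_{t,q}(\vec{\mathsf{x}})=\prod_{1\le i<j\le m}\frac{\left(q^{j-i-1}t^{\mathsf{x}_i-\mathsf{x}_j-j+i+1};t\right)_\infty}{\left(q^{j-i}t^{\mathsf{x}_i-\mathsf{x}_j-j+i+1};t\right)_\infty}.$$ For $\vec{\mathsf{x}},\vec{\mathsf{y}}\in\mathbb{W}_m$ with $\mathsf{y}_i-\mathsf{x}_i\in\{-1,0\}$ for all $i$, $$\Upsilon_m(\vec{\mathsf{x}},\vec{\mathsf{y}})=t^{-\binom m2}\,\frac{V_{t,q}(\vec{\mathsf{y}})}{V_{t,q}(\vec{\mathsf{x}})}\prod_{\substack{1\le i<j\le m\\ \mathsf{y}_i=\mathsf{x}_i,\ \mathsf{y}_j=\mathsf{x}_j-1}}\frac{(1-t^{i-j+\mathsf{x}_i-\mathsf{x}_j+1}q^{j-i-1})(1-t^{i-j+\mathsf{x}_i-\mathsf{x}_j}q^{j-i+1})}{(1-t^{i-j+\mathsf{x}_i-\mathsf{x}_j+1}q^{j-i})(1-t^{i-j+\mathsf{x}_i-\mathsf{x}_j}q^{j-i})}\prod_{i:\,\mathsf{y}_i=\mathsf{x}_i}t^{\mathsf{x}_i}\prod_{i:\,\mathsf{y}_i=\mathsf{x}_i-1}\left(t^{m-i}-q^{m-i}t^{\mathsf{x}_i}\right).$$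 Setting $q=0$ means substituting $q=0$ in this formula with the convention $0^0=1$ (all denominators remain nonzero). *)

(* Defs.v *)
From HB Require Import structures.
From mathcomp Require Import all_boot all_order all_algebra.
From mathcomp Require Import all_classical all_reals all_analysis.
Set Implicit Arguments.
Unset Strict Implicit.
Unset Printing Implicit Defensive.
Import Order.TTheory GRing.Theory Num.Theory.
Import numFieldNormedType.Exports.
Local Open Scope ring_scope.

(* Indices run from 1 to m: x`_[1], ..., x`_[m]. Outside this range the value
   is a junk one, and is never used for m >= 1. *)
Definition coord (m : nat) (x : m.-tuple int) (i : nat) : int := nth 0 x i.-1.

Notation "x `_[ i ]" := (coord x i)
  (at level 3, i at level 200, left associativity, format "x `_[ i ]")
  : ring_scope.

Definition W (m : nat) (x : m.-tuple int) : Prop :=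
  (forall i : nat, (1 <= i < m)%N -> x`_[i] > x`_[i.+1]) /\ x`_[m] >= 0.

Definition qpoch (R : realType) (z p : R) : R :=
  limn (fun n : nat => \prod_(0 <= i < n) (1 - z * p ^+ i)).

(* Powers of t have integer exponents. Powers of q have natural-number exponents;
   the truncated subtractions are exact since i < j <= m, and 0 ^+ 0 = 1. *)
Definition V (R : realType) (t q : R) (m : nat) (x : m.-tuple int) : R :=
  \prod_(1 <= i < m.+1) \prod_(i.+1 <= j < m.+1)
    (qpoch (q ^+ (j - i - 1) * t ^ (x`_[i] - x`_[j] - j%:Z + i%:Z + 1)) t /
     qpoch (q ^+ (j - i) * t ^ (x`_[i] - x`_[j] - j%:Z + i%:Z + 1)) t).

Definition Upsilon (R : realType) (t q : R) (m : nat) (x y : m.-tuple int) : R :=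
  t ^- 'C(m, 2) * (V t q y / V t q x) *
  (\prod_(1 <= i < m.+1)
    \prod_(i.+1 <= j < m.+1 | (y`_[i] == x`_[i]) && (y`_[j] == x`_[j] - 1))
      (((1 - t ^ (i%:Z - j%:Z + x`_[i] - x`_[j] + 1) * q ^+ (j - i - 1)) *
        (1 - t ^ (i%:Z - j%:Z + x`_[i] - x`_[j]) * q ^+ (j - i + 1))) /
       ((1 - t ^ (i%:Z - j%:Z + x`_[i] - x`_[j] + 1) * q ^+ (j - i)) *
        (1 - t ^ (i%:Z - j%:Z + x`_[i] - x`_[j]) * q ^+ (j - i))))) *
  (\prod_(1 <= i < m.+1 | y`_[i] == x`_[i]) t ^ x`_[i]) *
  (\prod_(1 <= i < m.+1 | y`_[i] == x`_[i] - 1)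
     (t ^+ (m - i) - q ^+ (m - i) * t ^ x`_[i])).

(* Main.v *)
Require Import Defs.
From HB Require Import structures.
From mathcomp Require Import all_boot all_order all_algebra.
From mathcomp Require Import all_classical all_reals all_analysis.
From mathcomp Require Import ring lra zify.
Set Implicit Arguments.
Unset Strict Implicit.
Unset Printing Implicit Defensive.
Import Order.TTheory GRing.Theory Num.Theory.
Import numFieldNormedType.Exports.
Local Open Scope ring_scope.

(** At q = 0 a factor of V or of the pair product that carries a positive
power of q is trivial, so only adjacent pairs (i, i+1) survive.  With
d_i = x_i - x_(i+1), this gives V(x) = prod_(i < m) (t^(d_i); t)_oo
([V_q0]), and the surviving pair factor is 1 - t^(d_i), present exactly when
x_i stays and x_(i+1) drops by one ([pair_factor_q0] and [V_ratio_factor]).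

From x to y the gap d_i changes by 1, 0 or -1, and the functional equation
(z; t)_oo = (1 - z) (zt; t)_oo ([qpochS]) evaluates the quotient of Pochhammer
symbols.  When the gap grows, the quotient is 1 / (1 - t^(d_i)), which the
surviving pair factor cancels; when it shrinks, the quotient is
1 - t^(d_i - 1), the factor of the claimed formula.  The single-index factors
t^(m-i) - q^(m-i) t^(x_i) lose their second term except for i = m.

The one analytic input is that (z; t)_oo converges and does not vanish for
0 <= z < 1 ([qpoch_cvg], [qpoch_neq0]), so that the quotients may be simplified. *)

Section Pochhammer.
Variables (R : realType) (t : R).
Hypotheses (t_ge0 : 0 <= t) (t_lt1 : t < 1).

Let qprod (z : R) (n : nat) : R := \prod_(0 <= i < n) (1 - z * t ^+ i).

Let qterm01 z i : 0 <= z <= 1 -> 0 <= 1 - z * t ^+ i <= 1.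
Proof.
move=> /andP[z0 z1]; rewrite subr_ge0 gerBl mulr_ge0 ?exprn_ge0// andbT.
by rewrite mulr_ile1 ?exprn_ge0 ?exprn_ile1// ltW.
Qed.

Let qprod_ge0 z n : 0 <= z <= 1 -> 0 <= qprod z n.
Proof. by move=> z01; apply: prodr_ge0 => i _; case/andP: (qterm01 i z01). Qed.

(** The partial products decrease and stay nonnegative. *)
Lemma qpoch_cvg z : 0 <= z <= 1 ->
  cvgn (fun n => \prod_(0 <= i < n) (1 - z * t ^+ i)).
Proof.
move=> z01; apply: (@nonincreasing_is_cvgn _ (qprod z)).
  apply/nonincreasing_seqP => n; rewrite /qprod big_nat_recr//=.
  by case/andP: (qterm01 n z01) => _ ?; rewrite ler_piMr// qprod_ge0.
by exists 0 => _ [n _ <-]; exact: qprod_ge0.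
Qed.

Lemma qpochS z : 0 <= z <= 1 -> qpoch z t = (1 - z) * qpoch (z * t) t.
Proof.
move=> /andP[z0 z1].
have zt01 : 0 <= z * t <= 1 by rewrite mulr_ge0//= mulr_ile1// ltW.
apply: cvg_lim => //; rewrite -cvg_shiftS /=.
have -> : (fun n => \prod_(0 <= i < n.+1) (1 - z * t ^+ i)) =
          (fun n => (1 - z) * \prod_(0 <= i < n) (1 - z * t * t ^+ i)).
  apply/funext => n; rewrite big_nat_recl//= expr0 mulr1; congr (_ * _).
  by apply: eq_bigr => i _; rewrite exprS mulrA.
by apply: cvgMr; exact: qpoch_cvg.
Qed.

Lemma qpoch0 : qpoch 0 t = 1.
Proof.
rewrite /qpoch; under eq_fun do
  (under eq_bigr do rewrite mul0r subr0; rewrite big1_eq).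
exact: lim_cst.
Qed.

(** From the Weierstrass inequality [prod (1 - a_i) >= 1 - sum a_i], with the
geometric sum bounded by its limit. *)
Lemma qpoch_ge z : 0 <= z <= 1 -> 1 - z / (1 - t) <= qpoch z t.
Proof.
move=> z01; have /andP[z0 z1] := z01.
have t1 : 0 < 1 - t by rewrite subr_gt0.
apply: limr_ge; first exact: qpoch_cvg.
apply: nearW => n.
(* The remainder of the geometric sum is kept, to make the induction go through. *)
suff: 1 - z * (1 - t ^+ n) / (1 - t) <= qprod z n.
  apply: le_trans; rewrite lerB// ler_pM2r ?invr_gt0//.
  by rewrite ler_piMr// gerBl exprn_ge0.
elim: n => [|n IH]; first by rewrite /qprod big_geq// expr0 subrr mulr0 mul0r subr0.
rewrite /qprod big_nat_recr//= -/(qprod z n).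
have p1 : qprod z n <= 1.
  by apply: prodr_ile1 => i _; exact: qterm01.
have p0 := qprod_ge0 n z01.
have zt : 0 <= z * t ^+ n by rewrite mulr_ge0 ?exprn_ge0.
have -> : 1 - z * (1 - t ^+ n.+1) / (1 - t) =
          1 - z * (1 - t ^+ n) / (1 - t) - z * t ^+ n.
  by rewrite exprS; field; rewrite gt_eqF.
nra.
Qed.

(** The Weierstrass bound is positive only for small [z]; peeling off finitely
many nonzero factors replaces [z] by [z * t ^+ N]. *)
Lemma qpoch_neq0 z : 0 <= z < 1 -> qpoch z t != 0.
Proof.
move=> /andP[z0 z1].
have t1 : 0 < 1 - t by rewrite subr_gt0.
have [N tN] : exists N, t ^+ N < 1 - t.
  have /cvgrPdist_lt/(_ _ t1)[N _ /(_ N)/=] : (t ^+ n @[n --> \oo] --> (0 : R))%classic.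
    by apply: cvg_expr; rewrite ger0_norm.
  by rewrite sub0r normrN ger0_norm ?exprn_ge0// => /(_ (leqnn N)) ?; exists N.
have {tN} : z * t ^+ N < 1 - t.
  by apply: le_lt_trans tN; rewrite ler_piMl ?exprn_ge0// ltW.
elim: N z z0 z1 => [|N IH] z z0 z1 ztN.
  rewrite expr0 mulr1 in ztN; have z01 : 0 <= z <= 1 by rewrite z0 ltW.
  rewrite gt_eqF// (lt_le_trans _ (qpoch_ge z01))//.
  by rewrite subr_gt0 ltr_pdivrMr// mul1r.
rewrite qpochS ?z0 ?ltW// mulf_neq0//; first by rewrite subr_eq0 gt_eqF.
apply: IH; first by rewrite mulr_ge0.
  by rewrite (le_lt_trans _ z1)// ler_piMr// ltW.
by rewrite -mulrA -exprS.
Qed.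

End Pochhammer.

Lemma prod_adjacent_pairs (R : comNzRingType) (F : nat -> nat -> R) (m : nat) :
    (0 < m)%N -> (forall i j, (i.+1 < j)%N -> F i j = 1) ->
  \prod_(1 <= i < m.+1) \prod_(i.+1 <= j < m.+1) F i j =
  \prod_(1 <= i < m) F i i.+1.
Proof.
move=> m0 F1; rewrite big_nat_recr//= [X in _ * X]big_geq// mulr1.
apply: eq_big_nat => i /andP[_ im].
rewrite big_ltn// big_nat_cond big1 ?mulr1// => j /andP[/andP[ij _] _].
exact: F1.
Qed.

Lemma V_q0 (R : realType) (t : R) m (x : m.-tuple int) : (0 < m)%N ->
  V t 0 x = \prod_(1 <= i < m) qpoch (t ^ (x`_[i] - x`_[i.+1])) t.
Proof.
move=> m0; rewrite /V prod_adjacent_pairs// => [|i j ij].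
  apply: eq_bigr => i _; rewrite subSnn subnn expr0 mul1r expr1 mul0r.
  rewrite qpoch0 divr1; congr (qpoch (t ^ _) t); lia.
have [k ->] : exists k, (j - i = k.+2)%N by exists (j - i - 2)%N; lia.
by rewrite subn1 !expr0n !mul0r qpoch0 divr1.
Qed.

Lemma pair_factor_q0 (F : fieldType) (i j : nat) (a b : F) : (i < j)%N ->
  ((1 - a * 0 ^+ (j - i - 1)) * (1 - b * 0 ^+ (j - i + 1))) /
  ((1 - a * 0 ^+ (j - i)) * (1 - b * 0 ^+ (j - i))) =
  if j == i.+1 then 1 - a else 1.
Proof.
move=> ij; rewrite !expr0n.
have -> : (j - i - 1 == 0)%N = (j == i.+1) by lia.
have -> : (j - i + 1 == 0)%N = false by lia.
have -> : (j - i == 0)%N = false by lia.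
by case: eqP => _; rewrite ?mulr0 ?mulr1 ?subr0 ?mulr1 divr1.
Qed.

Lemma index_factor (F : fieldType) (a a' : int) (u v : F) :
    a' = a - 1 \/ a' = a ->
  (if a' == a then u else 1) * (if a' == a - 1 then v else 1) =
  u * (a' == a)%:R + v * (a' == a - 1)%:R.
Proof.
have neqB1 : (a - 1 == a) = false by lia.
have neB1 : (a == a - 1) = false by lia.
by case=> ->; rewrite eqxx ?neqB1 ?neB1 /= ?mulr1 ?mulr0 ?mul1r ?addr0 ?add0r.
Qed.

Section AdjacentPair.
Variables (R : realType) (t : R).
Hypotheses (t_gt0 : 0 < t) (t_lt1 : t < 1).

Let exprz01 (d : int) : 1 <= d -> 0 <= t ^ d < 1.
Proof.
case: d => // -[|n]// _.
by rewrite -exprnP exprn_ge0 ?exprn_ilt1// ltW.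
Qed.

Lemma qpoch_exprz_neq0 (d : int) : 1 <= d -> qpoch (t ^ d) t != 0.
Proof. by move=> d1; apply: qpoch_neq0 => //; [exact: ltW|exact: exprz01]. Qed.

Lemma qpoch_exprzS (d : int) : 1 <= d ->
  qpoch (t ^ d) t = (1 - t ^ d) * qpoch (t ^ (d + 1)) t.
Proof.
move=> /exprz01/andP[td0 td1].
by rewrite expfzDr ?gt_eqF// expr1z -qpochS ?td0 ?ltW.
Qed.

(** One adjacent pair, in four cases.  If [(a, b)] moves to [(a, b - 1)],
the growing gap contributes the inverse of the surviving pair factor; if it
moves to [(a - 1, b)], the shrinking gap contributes the factor of the claimed
formula; otherwise the gap is constant and everything is trivial. *)
Lemma V_ratio_factor (a b a' b' : int) : b < a -> b' < a' ->
    a' = a - 1 \/ a' = a -> b' = b - 1 \/ b' = b ->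
  qpoch (t ^ (a' - b')) t / qpoch (t ^ (a - b)) t *
  (if (a' == a) && (b' == b - 1) then 1 - t ^ (a - b) else 1) =
  1 - t ^ (a - b - 1) * (a' == a - 1)%:R * (b' == b)%:R.
Proof.
move=> ab ab' a'E b'E.
have d1 : 1 <= a - b by lia.
have d1' : 1 <= a' - b' by lia.
have nz := qpoch_exprz_neq0 d1; have nz' := qpoch_exprz_neq0 d1'.
have neqB1 (c : int) : (c - 1 == c) = false by lia.
have neB1 (c : int) : (c == c - 1) = false by lia.
case: a'E b'E => -> [] -> in ab' d1' nz nz' *;
  rewrite ?eqxx ?neqB1 ?neB1 /= ?mulr0 ?mulr1 ?mul0r ?subr0.
- have -> : a - 1 - (b - 1) = a - b by lia.
  by rewrite divff.
- have -> : a - 1 - b = a - b - 1 by lia.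
  rewrite (@qpoch_exprzS (a - b - 1)); last by lia.
  by rewrite subrK mulfK.
- have e : a - (b - 1) = a - b + 1 by lia.
  rewrite (qpoch_exprzS d1) e in nz *.
  by move: nz; rewrite mulf_eq0 negb_or => /andP[? ?]; field; apply/andP.
- by rewrite divff.
Qed.

End AdjacentPair.

Theorem proposition4p3 (R : realType) (t : R) (t_gt0 : 0 < t) (t_lt1 : t < 1)
    (m : nat) (m_ge1 : (1 <= m)%N) (x y : m.-tuple int) (Wx : W x) (Wy : W y)
    (xy : forall i : nat, (1 <= i <= m)%N ->
            y`_[i] - x`_[i] = - 1 \/ y`_[i] - x`_[i] = 0) :
  Upsilon t 0 x y =
    t ^- 'C(m, 2) *
    (t ^ x`_[m] * (y`_[m] == x`_[m])%:R +
     (1 - t ^ x`_[m]) * (y`_[m] == x`_[m] - 1)%:R) *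
    \prod_(1 <= i < m)
      ((t ^ x`_[i] * (y`_[i] == x`_[i])%:R +
        t ^+ (m - i) * (y`_[i] == x`_[i] - 1)%:R) *
       (1 - t ^ (x`_[i] - x`_[i.+1] - 1) *
            (y`_[i] == x`_[i] - 1)%:R * (y`_[i.+1] == x`_[i.+1])%:R)).
Proof.
have step i : (1 <= i <= m)%N -> y`_[i] = x`_[i] - 1 \/ y`_[i] = x`_[i].
  by move=> /xy; lia.
rewrite /Upsilon !V_q0// -prodf_div.
under [X in _ * X * _ * _]eq_bigr do rewrite big_mkcond/=.
under [X in _ * X * _ * _]eq_big_nat => i _ do
  under eq_big_nat => j /andP[ij _] do rewrite (pair_factor_q0 _ _ ij).
rewrite prod_adjacent_pairs//; last first.
  by move=> i j ij; rewrite (gtn_eqF ij) if_same.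
rewrite [X in _ * X * _]big_mkcond [X in _ * X]big_mkcond/=.
rewrite !(@big_nat_recr _ _ _ m)//=.
rewrite subnn !expr0 mul1r.
rewrite -(index_factor _ _ (step m _)) ?m_ge1 ?leqnn//.
set P1 := \prod_(1 <= i < m) (_ / _).
set P2 := \prod_(1 <= i < m) (if _ && _ then _ else _).
set P3 := \prod_(1 <= i < m) (if _ == x`_[i] then _ else _).
set P4 := \prod_(1 <= i < m) (if _ == x`_[i] - 1 then _ else _).
set rhs := \prod_(1 <= i < m) _.
suff <- : P3 * P4 * (P1 * P2) = rhs.
  by move: (t ^- _) (if _ then _ else _) (if _ then _ else _) => c u v; ring.
rewrite /P1 /P2 /P3 /P4 -!big_split; apply: eq_big_nat => i /andP[i1 im] /=.
have i1m : (1 <= i <= m)%N by rewrite i1 ltnW.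
have gx : x`_[i] > x`_[i.+1] by apply: (proj1 Wx); rewrite i1.
have gy : y`_[i] > y`_[i.+1] by apply: (proj1 Wy); rewrite i1.
rewrite (index_factor _ _ (step i i1m)) eqxx.
rewrite -(V_ratio_factor t_gt0 t_lt1 gx gy (step i i1m) (step i.+1 im)).
have -> : i%:Z - i.+1%:Z + x`_[i] - x`_[i.+1] + 1 = x`_[i] - x`_[i.+1] by lia.
by rewrite expr0n subn_eq0 leqNgt im mul0r subr0.
Qed.
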